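(* Every finite simple undirected graph $G$ that is $2$-vertex-connected and series-parallel has a CAI-partition, i.e., there is a partition $V(G)=\mathcal{A}\cup\mathcal{I}$ into disjoint sets such that $\mathcal{A}$ induces a tree and $\mathcal{I}$ is an independent set.
   Context: A graph is $2$-vertex-connected if it is connected and has no cut-vertex, where a cut-vertex is a vertex whose removal disconnects the graph. A $2$-vertex-connected graph is series-parallel if and only if it contains no subdivision of $K_4$ (equivalently, it has treewidth at most $2$). For undirected graphs, a CAI-partition is a partition of the vertex set into a set inducing a connected acyclic subgraph (a tree) and an independent set. *)

(* Defs.v *)
(* A finite simple undirected graph is a finite vertex type T together with a
   symmetric, irreflexive adjacency relation e : rel T. *)
From mathcomp Require Import all_boot.

Set Implicit Arguments.
Unset Strict Implicit.
Unset Printing Implicit Defensive.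

Section Graphs.

Variables (T : finType) (e : rel T).

Definition induced (A : {set T}) : rel T :=
  [rel x y | [&& x \in A, y \in A & e x y]].

Definition all_linked (A : {set T}) : Prop :=
  {in A &, forall x y, connect (induced A) x y}.

(* The empty graph is not connected, so in particular a tree has at least
   one vertex. *)
Definition connected_on (A : {set T}) : Prop :=
  A != set0 /\ all_linked A.

(* Deleting the vertex of a one-vertex graph leaves no two vertices to
   separate, so it is not a cut-vertex. *)
Definition cut_vertex (v : T) : Prop := ~ all_linked [set~ v].

(* No lower bound on the order is imposed: the complete graphs on one and two
   vertices are 2-vertex-connected. *)
Definition two_vertex_connected : Prop :=
  connected_on [set: T] /\ forall v, ~ cut_vertex v.

(* The bound 3 <= size c excludes the empty sequence and the back-and-forth
   walk [:: x; y] along an edge, which are also ucycles. *)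
Definition acyclic_on (A : {set T}) : Prop :=
  forall c : seq T, 3 <= size c -> ~ ucycle (induced A) c.

Definition tree_on (A : {set T}) : Prop := connected_on A /\ acyclic_on A.

Definition independent (I : {set T}) : Prop :=
  {in I &, forall x y, ~~ e x y}.

(* b lists the four branch vertices; for i < j, p i j lists the inner vertices
   (possibly none) of the path replacing the edge ij of K_4. Values p i j with
   j <= i are irrelevant. *)
Definition K4_subdivision (b : 'I_4 -> T) (p : 'I_4 -> 'I_4 -> seq T) : Prop :=
  [/\ injective b,
      forall i j : 'I_4, i < j ->
        path e (b i) (rcons (p i j) (b j)) /\ uniq (p i j),
      forall i j k : 'I_4, i < j -> b k \notin p i j
    & forall i j k l : 'I_4, i < j -> k < l -> (i, j) != (k, l) ->
        forall x, x \in p i j -> x \notin p k l].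

(* The usual description of series-parallel graphs among the
   2-vertex-connected ones; only meant to be used for the latter. *)
Definition series_parallel : Prop := ~ exists b p, K4_subdivision b p.

Definition CAI_partition (A I : {set T}) : Prop :=
  [/\ A :|: I = [set: T], [disjoint A & I], tree_on A & independent I].

End Graphs.

(* Main.v *)
Require Import Defs.
From mathcomp Require Import all_boot.
From mathcomp Require Import zify.

Set Implicit Arguments.
Unset Strict Implicit.
Unset Printing Implicit Defensive.

(** A single vertex is a tree; otherwise choose an edge st. The graph is built
    from single edges by series and parallel compositions of two-terminal
    networks, and along such a decomposition three kinds of partial solution can be maintained at once. A
    network is given by its set W of inner vertices, attached to the rest of
    the graph only at its terminals s and t. In each case below every
    neighbour of an unchosen vertex of W is chosen:
    - [joined_tree]: a tree containing s and t;
    - [pendant_tree]: a tree containing s but not t;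
    - [split_forest]: two trees, one containing s and the other t, with no edge
      between them, the edge st being disregarded.

    In a parallel composition a joined tree of one part and a split forest of
    the other make a joined tree, and parts of equal kind make the other two
    kinds. In a series composition with middle vertex m, two joined trees make
    a joined tree provided st is not an edge, a joined tree and a tree pendant from m make a pendant tree,
    and two pendant trees that both avoid m make a split forest. If st is an
    edge, it turns a split forest into a joined tree. So every network has
    solutions of all three kinds ([network_solvable]); a joined tree for the
    network of all vertices but s and t is the tree of the partition, and the
    vertices outside it are the independent set.

    That a network with inner vertices decomposes is where K_4 comes in. If
    some inner vertex separates s from t, the network is a series composition
    ([split_at_cut_vertex]); if W is disconnected, it is a parallel one
    ([split_components]). Otherwise there are two internally disjoint paths
    from s to t through W ([two_paths_connect]), a path inside W linking them,
    and a path from s to t outside W ([outside_connect]): these form a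
    subdivision of K_4 ([inseparable_K4]).

    Trees are handled through [grow]: adding a vertex with exactly one
    neighbour in the current set, again and again, produces a tree from a
    single vertex. Gluing two networks at terminals is then a concatenation of
    two such constructions ([grow_frame]). *)

(** * Disjoint paths *)

Lemma uniq_countP (T : eqType) (P : seq T) :
  reflect (forall z, count_mem z P <= 1) (uniq P).
Proof.
apply: (iffP idP) => [uP z|cP]; first by rewrite count_uniq_mem // leq_b1.
apply: count_mem_uniq => z; have := cP z.
by rewrite -has_pred1 has_count; case: (count_mem z P) => [|[|n]].
Qed.

Lemma count_le_uniq (T : eqType) (P Q : seq T) :
  (forall z, count_mem z Q <= count_mem z P) -> uniq P -> uniq Q.
Proof.
by move=> leQP /uniq_countP uP; apply/uniq_countP => z; apply: leq_trans (uP z).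
Qed.

(** Disjointness of path segments that are cut and pasted is a linear
    inequality between multiplicities. *)
Ltac uniq_from uP :=
  let z := fresh in
  apply: count_le_uniq uP => z; clear;
  rewrite -?cats1 /= ?count_cat /= ?count_cat /= ?count_cat /=;
  repeat match goal with |- context [nat_of_bool ?b] =>
    generalize (nat_of_bool b); intro end;
  lia.

Section Paths.

Variable T : finType.
Implicit Types (h : rel T) (P Q R M : seq T) (X : {set T}).

Lemma connect_leave h X x y : connect h x y -> x \in X -> y \notin X ->
  exists a b, [/\ a \in X, b \notin X & h a b].
Proof.
case/connectP=> l; elim: l x => [|a l IHl] x /= => [_ -> -> //|].
case/andP=> hxa hl Dy xX yX; have [aX | aX] := boolP (a \in X).
  exact: IHl hl Dy aX yX.
by exists x, a.
Qed.

(** A shortest segment of the path between A and B: an inner vertex in A or B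
    would let the path be shortened to the part after or before it. *)
Lemma linking_path h (A B : {pred T}) x R y :
    path h x (rcons R y) -> uniq R -> x \in A -> y \in B ->
  exists a M b, [/\ a \in A, b \in B, path h a (rcons M b), uniq M
                  & {in M, forall z, (z \notin A) && (z \notin B)}].
Proof.
have [n leRn] := ubnP (size R); elim: n x R y leRn => // n IHn x R y leRn.
move=> hR uR xA yB.
have [/hasP[z zR zAB]|/hasPn noAB] := boolP (has [predU A & B] R); last first.
  by exists x, R, y; split=> // z /noAB; rewrite inE negb_or.
case/splitPr: zR => R1 R2 in leRn hR uR.
move: hR uR; rewrite rcons_cat rcons_cons -cat_rcons cat_path last_rcons cat_uniq /=.
rewrite size_cat /= in leRn.
case/andP=> hR1 hR2 /and4P[uR1 _ _ uR2].
case/orP: zAB => [zA|zB].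
- by apply: IHn hR2 uR2 zA yB; lia.
- by apply: IHn hR1 uR1 xA zB; lia.
Qed.

Lemma connect_uniq_path h x y : x != y -> connect h x y ->
  exists2 R, path h x (rcons R y) & uniq (x :: y :: R).
Proof.
move=> neq_xy /connectP[l hl Dy]; case/shortenP: hl Dy => l' hl' ul' _ Dy.
case/lastP: l' => [|R z] in hl' ul' Dy; first by rewrite Dy eqxx in neq_xy.
rewrite last_rcons in Dy; subst z; exists R => //.
by rewrite -(perm_uniq (s1 := x :: rcons R y)) // perm_cons perm_rcons.
Qed.

Definition avoid h m : rel T := [rel x y | [&& h x y, x != m & y != m]].

Lemma avoid_path h m x R : path (avoid h m) x R -> path h x R /\ m \notin R.
Proof.
elim: R x => //= y R IHR x /andP[/and3P[-> _ ym] /IHR[-> mR]].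
by rewrite inE negb_or eq_sym ym.
Qed.

Section TwoPaths.

Variables (h : rel T) (s : T).

(** Inner vertices only are listed in P and Q; both lists may be empty, so a
    neighbour x of s satisfies this by taking the edge sx twice. *)
Definition two_paths x := exists P Q,
  [/\ path h s (rcons P x), path h s (rcons Q x) & uniq (s :: x :: P ++ Q)].

(** R is an escape from the path through P at the vertex z, leading to y
    without meeting either path again: follow P up to z and then R for the first
    new path, and prolong the path through Q by the edge xy for the second. *)
Lemma reroute x y P Q z R :
    path h s (rcons P x) -> path h s (rcons Q x) -> h x y ->
    z \in s :: P -> path h z (rcons R y) -> uniq (y :: R ++ [:: s, x & P ++ Q]) ->
  two_paths y.
Proof.
move=> hP hQ hxy; rewrite inE => /predU1P[->|zP] hR uR.
  exists R, (rcons Q x); split=> //.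
    by rewrite rcons_path hQ last_rcons.
  by uniq_from uR.
case/splitPr: zP => P1 P2 in hP uR.
exists (rcons P1 z ++ R), (rcons Q x); split.
- move: hP; rewrite rcons_cat rcons_cons -cat_rcons !rcons_cat !cat_path last_rcons.
  by case/andP=> -> _.
- by rewrite rcons_path hQ last_rcons.
by uniq_from uR.
Qed.

(** Whitney's induction step: a path from s to y avoiding x is followed from the
    last vertex that it shares with the two paths to x. *)
Lemma two_pathsS x y : two_paths x -> h x y -> y != s ->
  connect (avoid h x) s y -> two_paths y.
Proof.
case=> P [Q [hP hQ uPQ]] hxy yNs.
rewrite eq_sym in yNs; case/(connect_uniq_path yNs) => R /[dup] hR.
case/avoid_path=> _; rewrite mem_rcons inE negb_or => /andP[xNy _] uR.
have uQP : uniq [:: s, x & Q ++ P].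
  by uniq_from uPQ.
have cut P1 Q1 : path h s (rcons P1 x) -> path h s (rcons Q1 x) ->
    uniq [:: s, x & P1 ++ Q1] -> y \in P1 -> two_paths y.
  move=> hP1 hQ1 uPQ1 yP1; case/splitPr: yP1 => P2 P3 in hP1 uPQ1.
  exists P2, (rcons Q1 x); split.
  - move: hP1; rewrite rcons_cat rcons_cons -cat_rcons !cat_path.
    by case/andP.
  - by rewrite rcons_path hQ1 last_rcons.
  by uniq_from uPQ1.
have [yP|yP] := boolP (y \in P); first exact: cut hP hQ uPQ yP.
have [yQ|yQ] := boolP (y \in Q); first exact: cut hQ hP uQP yQ.
have sPQ : s \in [predU s :: P & s :: Q] by rewrite !inE eqxx.
have uR' : uniq R by case/and3P: uR.
have yy : y \in pred1 y by rewrite inE.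
(* M is the part of the path to y after its last vertex z on the paths to x. *)
have [z [M [b [zPQ /eqP-> {b} hM uM dM]]]] := linking_path hR uR' sPQ yy.
have [{}hM] := avoid_path hM; rewrite mem_rcons inE negb_or => /andP[_ xM].
have uAll : uniq (y :: M ++ [:: s, x & P ++ Q]).
  rewrite cons_uniq cat_uniq uM uPQ mem_cat !inE mem_cat (negPf yP) (negPf yQ).
  rewrite eq_sym (negPf yNs) eq_sym (negPf xNy) !orbF andbT.
  have [/dM|_] := boolP (y \in M); first by rewrite !inE eqxx andbF.
  apply/hasPn => w; rewrite !inE mem_cat => wX; apply/negP => wM.
  have:= dM w wM; rewrite !inE !negb_or.
  case/andP=> /andP[/andP[/negPf ws /negPf wP] /andP[_ /negPf wQ]] _.
  by move: wX xM; rewrite ws wP wQ !orbF /= => /eqP<-; rewrite wM.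
case/orP: zPQ => zP; first exact: reroute hP hQ hxy zP hM uAll.
apply: reroute hQ hP hxy zP hM _.
by uniq_from uAll.
Qed.

Lemma two_paths_connect t : s != t ->
    (forall x y, x != s -> h x y -> y != s -> connect (avoid h x) s y) ->
  connect h s t -> two_paths t.
Proof.
move=> sNt noCut /(connect_uniq_path sNt)[R].
elim/last_ind: R t {sNt} => [|R x IHR] t hR uR.
  by exists [::], [::]; move: uR => /= /andP[]; rewrite inE => ->.
move: hR; rewrite rcons_path last_rcons => /andP[hR hxt].
have uR' : uniq [:: s, x & R].
  by uniq_from uR.
have xNs : x != s by case/andP: uR'; rewrite inE negb_or eq_sym => /andP[].
have tNs : t != s by case/andP: uR; rewrite inE negb_or eq_sym => /andP[].
exact: two_pathsS (IHR x hR uR') hxt tNs (noCut x t xNs hxt tNs).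
Qed.

End TwoPaths.

(** The branch vertices are taken in the order s, p, q, t, so that every given
    path runs from its lower to its higher end. *)
Lemma K4_of_paths (e : rel T) s p q t P1 Q1 R M P2 Q2 :
    uniq ([:: s; p; q; t] ++ P1 ++ Q1 ++ R ++ M ++ P2 ++ Q2) ->
    path e s (rcons P1 p) -> path e s (rcons Q1 q) -> path e s (rcons R t) ->
    path e p (rcons M q) -> path e p (rcons P2 t) -> path e q (rcons Q2 t) ->
  exists b p, K4_subdivision e b p.
Proof.
move=> uA eP1 eQ1 eR eM eP2 eQ2.
pose b (i : 'I_4) := nth s [:: s; p; q; t] i.
pose pp (i j : 'I_4) := nth [::] (nth [::]
  [:: [:: [::]; P1; Q1; R]; [:: [::]; [::]; M; P2]; [:: [::]; [::]; [::]; Q2]] i) j.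
exists b, pp.
move: uA; rewrite cat_uniq => /and3P[ub /hasPn/= bN uA].
split.
- by move=> i j /eqP;
  rewrite (nth_uniq s (s := [:: s; p; q; t]) (ltn_ord i) (ltn_ord j) ub) => /eqP/val_inj.
- have [u1 u2 u3 [u4 u5 u6]] :
    [/\ uniq P1, uniq Q1, uniq R & [/\ uniq M, uniq P2 & uniq Q2]].
    by move: uA; rewrite !cat_uniq => /and5P[-> _ -> _ /and5P[-> _ -> _ /and3P[]]].
  by case=> [[|[|[|[|]]]]] // ? [[|[|[|[|]]]]] //= ? _; rewrite /b /pp /=.
- move=> i j k ij; apply/negP => bp.
  have /bN/negP[] : b k \in P1 ++ Q1 ++ R ++ M ++ P2 ++ Q2.
    by move: bp ij; case: i j => [[|[|[|[|]]]]] // ? [[|[|[|[|]]]]] //= ? bp _;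
      rewrite !mem_cat bp ?orbT.
  exact: (mem_nth s (s := [:: s; p; q; t]) (ltn_ord k)).
move=> i j k l ij kl ijkl x xij; apply/negP => xkl.
move/uniq_countP/(_ x): uA; rewrite !count_cat.
move: xij xkl; rewrite -!has_pred1 !has_count.
clear -ij kl ijkl; case: i j ij k l kl ijkl => [[|[|[|[|]]]]] // ? [[|[|[|[|]]]]] //= ? _
  [[|[|[|[|]]]]] // ? [[|[|[|[|]]]]] //= ? _; rewrite /pp ?eqxx //=; lia.
Qed.

End Paths.

(** * Growing trees *)

Section Growth.

Variables (T : finType) (e : rel T).
Hypotheses (e_sym : symmetric e) (e_irr : irreflexive e).
Implicit Types (A B C : {set T}).

(** Starting from B, vertices are added one by one, each with a single neighbour
    y among those present. The subgraph induced on B itself is arbitrary: for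
    B = {s, t} this describes a tree at s and a tree at t whether or not st is an
    edge. *)
Inductive grow B : {set T} -> Prop :=
| grow_refl : grow B B
| grow_add A x y of grow B A & x \notin A & y \in A & e x y &
    (forall z, z \in A -> e x z -> z = y) : grow B (x |: A).

Lemma grow_sub B A : grow B A -> B \subset A.
Proof.
by elim=> // {}A x y _ sBA _ _ _ _; apply: subset_trans sBA (subsetUr _ _).
Qed.

Lemma grow_trans A B C : grow B A -> grow A C -> grow B C.
Proof.
by move=> gBA; elim=> // {}C x y _ gBC xC yC exy unq; apply: grow_add yC exy unq.
Qed.

(** The construction of A from B can be replayed on top of a larger start C, since
    the vertices that it adds see nothing new in C. *)
Lemma grow_frame A B C : grow B A -> B \subset C ->
    (forall x, x \in A -> x \notin B ->
       x \notin C /\ forall z, z \in C -> e x z -> z \in B) ->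
  grow C (C :|: A).
Proof.
move=> gBA sBC; elim: gBA => [|{}A x y gBA IHA xA yA exy unq] frame.
  by rewrite (setUidPl sBC); apply: grow_refl.
have xB : x \notin B by apply: contra xA; apply/subsetP/grow_sub.
have [xC Cx] := frame x (setU11 _ _) xB.
rewrite setUCA; apply: (grow_add (y := y)) => //.
- by apply: IHA => z zA; apply: frame; rewrite inE zA orbT.
- by rewrite inE negb_or xC.
- by rewrite inE yA orbT.
move=> z; rewrite inE => /orP[zC exz|]; last exact: unq.
by apply: unq => //; apply: (subsetP (grow_sub gBA)); apply: Cx.
Qed.

(** A cycle through the last added vertex would give it two neighbours. *)
Lemma grow_acyclic A B : grow B A -> acyclic_on e B -> acyclic_on e A.
Proof.
move=> gBA acB; elim: gBA => // {}A x y _ acA xA yA exy unq c c3 /andP[cc uc].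
have [xc|xc] := boolP (x \in c); last first.
  apply: (acA c c3); rewrite /ucycle uc andbT.
  apply: (sub_in_cycle (P := predC1 x)) cc.
    move=> a b; rewrite !inE => /negPf xa /negPf xb.
    by rewrite /induced /= !inE xa xb.
  by apply/allP => z zc; apply: contraNneq xc => <-.
have [i p Dp] := rot_to xc.
rewrite -(size_rot i) -(rot_cycle i) -(rot_uniq i) in c3 cc uc.
rewrite {}Dp in c3 cc uc; move: c3 cc uc.
case: p => [|a p] //; case/lastP: p => [|p b] // _.
rewrite /= rcons_path last_rcons /induced /=.
case/and3P=> [/and3P[_ aA exa] _ /and3P[bA _ ebx]].
rewrite !inE !mem_rcons !inE !negb_or.
case/and3P=> /and3P[xa xb _] /andP[ab _] _.
case/eqP: ab; rewrite e_sym in ebx.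
move: aA bA; rewrite !inE ![_ == x]eq_sym (negPf xa) (negPf xb) /= => aA bA.
by rewrite (unq a) // (unq b).
Qed.

Lemma induced_sym A : symmetric (induced e A).
Proof. by move=> x y; rewrite /induced /= e_sym andbCA. Qed.

Lemma grow_tree x A : grow [set x] A -> tree_on e A.
Proof.
move=> gA; split; last first.
  apply: (grow_acyclic gA) => c c3 /andP[cc uc].
  case: c c3 cc uc => [|a [|b c]] //= _ /andP[/and3P[]].
  by rewrite !inE => /eqP-> /eqP->; rewrite e_irr.
have xA : x \in A by apply: (subsetP (grow_sub gA)); rewrite inE.
split; first by apply/set0Pn; exists x.
suffices root : {in A, forall y, connect (induced e A) x y}.
  move=> y z yA zA; apply: connect_trans (root z zA).
  by rewrite (sym_connect_sym (@induced_sym A)) root.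
elim: gA {xA} => [|{}A y z gA IHA yA zA eyz _] w.
  by rewrite inE => /eqP->.
have incl a : a \in A -> connect (induced e (y |: A)) x a.
  move/IHA; apply: connect_sub => b c /= /and3P[bA cA ebc].
  by apply: connect1; rewrite /induced /= ebc !inE bA cA !orbT.
rewrite inE => /orP[|/incl//]; rewrite inE => /eqP->.
apply: connect_trans (incl z zA) (connect1 _).
by rewrite /induced /= e_sym eyz !inE eqxx zA orbT.
Qed.

End Growth.

(** * Partial solutions of networks *)

Section Networks.

Variables (T : finType) (e : rel T).
Hypotheses (e_sym : symmetric e) (e_irr : irreflexive e).
Implicit Types (A W X : {set T}) (s t m : T).

Definition attached W s t :=
  forall x y, x \in W -> e x y -> y \in [set s; t] :|: W.

(** Independence of the complement of A, phrased from the inner vertices so that it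
    ignores an edge between the terminals and passes to compositions. In all
    uses some terminal lies in A, so such an edge does no harm. *)
Definition covers W A := forall x y, x \in W -> x \notin A -> e x y -> y \in A.

Definition joined_tree W s t := exists A,
  [/\ A \subset [set s; t] :|: W, t \in A, grow e [set s] A & covers W A].
(** The other terminal, lying outside s |: W, is left out of the tree. *)
Definition pendant_tree W s := exists A,
  [/\ A \subset s |: W, grow e [set s] A & covers W A].
Definition split_forest W s t := exists A,
  [/\ A \subset [set s; t] :|: W, grow e [set s; t] A & covers W A].

Lemma attachedC W s t : attached W s t -> attached W t s.
Proof. by move=> N x y xW /(N x y xW); rewrite (setUC [set s]). Qed.

Lemma joined_tree_edge W s t : s != t -> e s t ->
  split_forest W s t -> joined_tree W s t.
Proof.
move=> sNt est [A [sA gA cA]]; exists A; split=> //.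
  by apply: (subsetP (grow_sub gA)); rewrite !inE eqxx orbT.
apply: grow_trans gA; rewrite setUC.
apply: (grow_add (grow_refl _ _) (y := s)); rewrite ?inE // 1?eq_sym //.
  by rewrite e_sym.
by move=> z; rewrite inE => /eqP.
Qed.

Section Series.

Variables (W1 W2 : {set T}) (s m t : T).
Hypotheses (sNt : s != t) (sNm : s != m) (tNm : t != m).
Hypotheses (sW1 : s \notin W1) (sW2 : s \notin W2).
Hypotheses (tW1 : t \notin W1) (tW2 : t \notin W2).
Hypotheses (mW1 : m \notin W1) (mW2 : m \notin W2).
Hypothesis disj : forall x, x \in W1 -> x \notin W2.
Hypotheses (N1 : attached W1 s m) (N2 : attached W2 m t).
Let W := m |: (W1 :|: W2).

Lemma series_covers A1 A2 : m \in A1 :|: A2 ->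
  covers W1 A1 -> covers W2 A2 -> covers W (A1 :|: A2).
Proof.
move=> mA c1 c2 x y; rewrite !inE negb_or.
case/or3P=> [/eqP->|xW1|xW2] /andP[x1 x2] exy.
- by move: mA; rewrite inE (negPf x1) (negPf x2).
- by rewrite (c1 x).
- by rewrite (c2 x) ?orbT.
Qed.

(** Only the edge st can join the part of A2 beyond m to A1. *)
Lemma series_grow B A1 A2 : A1 \subset [set s; m] :|: W1 -> m \in A1 ->
    A2 \subset [set m; t] :|: W2 -> (t \in A2 -> ~~ e s t) ->
    grow e B A1 -> grow e [set m] A2 -> grow e B (A1 :|: A2).
Proof.
move=> s1 mA1 s2 est g1 g2; apply: grow_trans g1 _; apply: grow_frame g2 _ _.
  by rewrite sub1set.
move=> x xA2; rewrite inE => xm; have:= subsetP s2 x xA2.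
rewrite !inE (negPf xm) /= => xV.
have xA1 : x \notin A1.
  apply/negP=> /(subsetP s1); rewrite !inE (negPf xm) orbF.
  case/orP: xV => [/eqP->|xW2]; first by rewrite eq_sym (negPf sNt) (negPf tW1).
  by case/orP=> [/eqP xs|/disj]; [rewrite xs (negPf sW2) in xW2 | rewrite xW2].
split=> // z zA1 exz; rewrite inE; have:= subsetP s1 z zA1; rewrite !inE.
case/orP: xV => [/eqP xt|xW2].
  case/orP=> [/orP[/eqP zs|//]|zW1].
    rewrite zs xt e_sym in exz; rewrite xt in xA2; rewrite exz in est.
    by case/negP: (est xA2).
  rewrite e_sym in exz; have := N1 zW1 exz; rewrite xt !inE.
  by rewrite eq_sym (negPf sNt) (negPf tNm) (negPf tW1).
have:= N2 xW2 exz; rewrite !inE; case: (z == m) => //=.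
rewrite orbF; case/orP=> [/eqP->|zW2].
  by rewrite eq_sym (negPf sNt) (negPf tW1).
by case/orP=> [/eqP zs|/disj]; [rewrite zs (negPf sW2) in zW2 | rewrite zW2].
Qed.

Lemma series_joined : ~~ e s t ->
  joined_tree W1 s m -> joined_tree W2 m t -> joined_tree W s t.
Proof.
move=> est [A1 [s1 mA1 g1 c1]] [A2 [s2 tA2 g2 c2]]; exists (A1 :|: A2); split.
- apply/subsetP => x; rewrite inE.
  by case/orP=> [/(subsetP s1)|/(subsetP s2)]; rewrite !inE;
    case/orP=> [/orP[]|] ->; rewrite ?orbT.
- by rewrite inE tA2 orbT.
- exact: series_grow.
- by apply: series_covers => //; rewrite inE mA1.
Qed.

Lemma series_pendant :
  joined_tree W1 s m -> pendant_tree W2 m -> pendant_tree W s.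
Proof.
move=> [A1 [s1 mA1 g1 c1]] [A2 [s2 g2 c2]]; exists (A1 :|: A2); split.
- apply/subsetP => x; rewrite inE.
  case/orP=> [/(subsetP s1)|/(subsetP s2)]; rewrite !inE.
    by case/orP=> [/orP[]|] ->; rewrite ?orbT.
  by case/orP=> ->; rewrite ?orbT.
- apply: series_grow => //.
    apply: subset_trans s2 _; apply/subsetP=> x; rewrite !inE.
    by case/orP=> ->; rewrite ?orbT.
  by move/(subsetP s2); rewrite !inE (negPf tNm) (negPf tW2).
- by apply: series_covers => //; rewrite inE mA1.
Qed.

(** Here m is left out. Its neighbours are all chosen, because an inner vertex
    left out has only chosen neighbours and so is not adjacent to m. *)
Lemma series_split : attached W s t ->
  pendant_tree W1 s -> pendant_tree W2 t -> split_forest W s t.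
Proof.
move=> N [A1 [s1 g1 c1]] [A2 [s2 g2 c2]]; exists (A1 :|: A2).
have sA1 : s \in A1 by apply: (subsetP (grow_sub g1)); rewrite inE.
have tA2 : t \in A2 by apply: (subsetP (grow_sub g2)); rewrite inE.
have in1 x : x \in A1 -> x != s -> x \in W1.
  by move/(subsetP s1); rewrite !inE => /predU1P[->|//]; rewrite eqxx.
have in2 x : x \in A2 -> x != t -> x \in W2.
  by move/(subsetP s2); rewrite !inE => /predU1P[->|//]; rewrite eqxx.
split.
- apply/subsetP => x; rewrite inE.
  by case/orP=> [/(subsetP s1)|/(subsetP s2)]; rewrite !inE;
    case/orP=> ->; rewrite ?orbT.
- have -> : A1 :|: A2 = [set s; t] :|: A1 :|: A2.
    apply/setP => x; rewrite !inE.
    by case: eqP => [->|_]; rewrite ?sA1 //; case: eqP => [->|_]; rewrite ?tA2 ?orbT.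
  (* Both terminals are put in first, then the two trees are grown in turn. *)
  apply: grow_trans (grow_frame g1 _ _) (grow_frame g2 _ _).
  + by rewrite sub1set !inE eqxx.
  + move=> x xA1; rewrite inE => xs; have xW1 := in1 x xA1 xs.
    have xt : x != t by apply: contraNneq tW1 => <-.
    split=> [|z]; rewrite !inE ?negb_or ?xs //.
    case/orP=> // /eqP-> /(N1 xW1); rewrite !inE (negPf tNm) (negPf tW1).
    by rewrite !orbF.
  + by rewrite sub1set !inE eqxx orbT.
  move=> x xA2; rewrite inE => xt; have xW2 := in2 x xA2 xt.
  have xs : x != s by apply: contraNneq sW2 => <-.
  split=> [|z zC exz].
    rewrite !inE !negb_or xs xt /=; apply/negP => /in1 /(_ xs) /disj.
    by rewrite xW2.
  have:= N2 xW2 exz; rewrite !inE; case/orP=> [/orP[/eqP zm|//]|zW2].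
    move: zC; rewrite !inE zm [m == s]eq_sym [m == t]eq_sym (negPf sNm) (negPf tNm).
    by move/in1; rewrite eq_sym sNm (negPf mW1) => /(_ isT).
  move: zC; rewrite !inE => /orP[/orP[/eqP zs|//]|zA1].
    by rewrite zs (negPf sW2) in zW2.
  have zs : z != s by apply: contraNneq sW2 => <-.
  by have := disj (in1 z zA1 zs); rewrite zW2.
move=> x y; have mem1 z : z \in W1 -> e z m -> z \in A1.
  move=> zW1 ezm; apply: contraNT mW1 => zA1.
  by apply: in1; [apply: c1 ezm | rewrite eq_sym].
have mem2 z : z \in W2 -> e z m -> z \in A2.
  move=> zW2 ezm; apply: contraNT mW2 => zA2.
  by apply: in2; [apply: c2 ezm | rewrite eq_sym].
rewrite !inE negb_or => /or3P[/eqP->|xW1|xW2] /andP[x1 x2] exy.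
- have mW : m \in W by rewrite !inE eqxx.
  have := N m y mW exy; rewrite !inE.
  case/orP=> [/orP[]/eqP->|/or3P[/eqP ym|yW1|yW2]].
  + by rewrite sA1.
  + by rewrite tA2 orbT.
  + by rewrite ym e_irr in exy.
  + by rewrite mem1 // e_sym.
  + by rewrite mem2 ?orbT // e_sym.
- by rewrite (c1 x).
- by rewrite (c2 x) ?orbT.
Qed.

End Series.
Section Parallel.

Variables (W1 W2 : {set T}) (s t : T).
Hypotheses (sW1 : s \notin W1) (tW1 : t \notin W1).
Hypothesis disj : forall x, x \in W1 -> x \notin W2.
Hypothesis N2 : attached W2 s t.
Let W := W1 :|: W2.

Lemma parallel_covers A1 A2 :
  covers W1 A1 -> covers W2 A2 -> covers W (A1 :|: A2).
Proof.
move=> c1 c2 x y; rewrite !inE negb_or => /orP[] xW /andP[x1 x2] exy.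
  by rewrite (c1 x).
by rewrite (c2 x) ?orbT.
Qed.

(** S is the set of terminals present in both parts, which separates the rest of
    A2 from the rest of A1. *)
Lemma parallel_grow B S A1 A2 :
    A1 \subset S :|: W1 -> A2 \subset S :|: W2 -> S \subset A1 ->
  grow e B A1 -> grow e S A2 -> grow e B (A1 :|: A2).
Proof.
move=> s1 s2 sS g1 g2; apply: grow_trans g1 _; apply: grow_frame g2 sS _.
move=> x xA2 xS; have:= subsetP s2 x xA2; rewrite inE (negPf xS) /= => xW2.
split=> [|z zA1 exz].
  apply/negP=> /(subsetP s1); rewrite inE (negPf xS) /= => /disj.
  by rewrite xW2.
have:= subsetP s1 z zA1; rewrite inE => /orP[//|zW1].
have := N2 xW2 exz; rewrite !inE (negPf (disj zW1)) orbF.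
by case/orP=> /eqP zst; rewrite zst ?(negPf sW1) ?(negPf tW1) in zW1.
Qed.

Lemma parallel_sub S A1 A2 : A1 \subset S :|: W1 -> A2 \subset S :|: W2 ->
  A1 :|: A2 \subset S :|: W.
Proof. by move=> s1 s2; rewrite setUUr setUSS. Qed.

Lemma parallel_joined :
  joined_tree W1 s t -> split_forest W2 s t -> joined_tree W s t.
Proof.
move=> [A1 [s1 tA1 g1 c1]] [A2 [s2 g2 c2]]; exists (A1 :|: A2); split.
- exact: parallel_sub.
- by rewrite inE tA1.
- have stA1 : [set s; t] \subset A1.
    by rewrite subUset !sub1set tA1 andbT (subsetP (grow_sub g1)) ?inE.
  exact: parallel_grow s1 s2 stA1 g1 g2.
- exact: parallel_covers.
Qed.

Lemma parallel_pendant :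
  pendant_tree W1 s -> pendant_tree W2 s -> pendant_tree W s.
Proof.
move=> [A1 [s1 g1 c1]] [A2 [s2 g2 c2]]; exists (A1 :|: A2); split.
- exact: parallel_sub.
- exact: parallel_grow s1 s2 (grow_sub g1) g1 g2.
- exact: parallel_covers.
Qed.

Lemma parallel_split :
  split_forest W1 s t -> split_forest W2 s t -> split_forest W s t.
Proof.
move=> [A1 [s1 g1 c1]] [A2 [s2 g2 c2]]; exists (A1 :|: A2); split.
- exact: parallel_sub.
- exact: parallel_grow s1 s2 (grow_sub g1) g1 g2.
- exact: parallel_covers.
Qed.

End Parallel.

(** * Decomposition of networks *)

(** The last two fields exclude the degenerate networks: one with neither inner
    vertices nor an edge would admit no joined tree, and without an edge st or a
    vertex outside there would be no path from s to t around W, hence no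
    sixth path for a subdivision of K_4. *)
Record network W s t : Prop := Network {
  net_neq : s != t;
  net_s : s \notin W;
  net_t : t \notin W;
  net_attached : attached W s t;
  net_inner : e s t \/ W != set0;
  net_outer : e s t \/ exists r, r \notin [set s; t] :|: W }.

Lemma networkC W s t : network W s t -> network W t s.
Proof.
case=> sNt sW tW N i o.
split=> //; first by rewrite eq_sym.
- exact: attachedC.
- by rewrite e_sym.
- by rewrite e_sym (setUC [set t]).
Qed.

(** Biconnectedness in terms of cuts: if neither X nor the set of vertices
    outside X and v is empty, deleting v does not separate them. *)
Hypothesis no_cut : forall v X x r, x \in X -> v \notin X -> r \notin X ->
  r != v -> exists a b, [/\ a \in X, b \notin X, b != v & e a b].

(** When W is attached to s and t, these are the edges among W, s and t other
    than st. *)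
Definition inner W : rel T := [rel x y | e x y && ((x \in W) || (y \in W))].

Lemma inner_sym W : symmetric (inner W).
Proof. by move=> x y; rewrite /inner /= e_sym orbC. Qed.

Section OneNetwork.

Variables (W : {set T}) (s t : T).
Hypothesis net : network W s t.
Let V := [set s; t] :|: W.

Lemma inner_closed x y : inner W x y -> y \in V.
Proof.
case/andP=> exy /orP[xW|yW]; first exact: net_attached net _ _ xW exy.
by rewrite inE yW orbT.
Qed.

(** When st is not an edge, a vertex r outside the network reaches both s and t
    outside W: if r did not reach s, say, then t would separate s from the
    vertices that r reaches without passing through t. *)
Lemma outside_connect : connect (induced e (~: W)) s t.
Proof.
have [sNt sW tW N _ []] := net.
  by move=> est; apply: connect1; rewrite /induced /= !inE sW tW.
case=> r; rewrite !inE !negb_or => /andP[/andP[rs rt] rW].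
(* Stated for arbitrary terminals because it serves for s and for t. *)
have reach s' t' : attached W s' t' -> s' \notin W -> r != t' -> r != s' ->
    s' != t' -> connect (induced e (~: W)) r s'.
  move=> N' s'W rt' rs' s't'; pose h := induced e (~: W :\ t').
  have hout x : connect h r x -> x != t' /\ x \notin W.
    move=> hx; apply/andP; apply/negPn/negP => xX.
    have [||a [b [_ bX]]] := @connect_leave _ h (~: W :\ t') _ _ hx.
    - by rewrite !inE rt' rW.
    - by rewrite !inE.
    by rewrite /h /induced /= (negPf bX) andbF.
  have: connect h r s'.
    apply/negPn/negP=> rs'X.
    have [||||a [b [aX bX bt' eab]]] := @no_cut t' [set x | connect h r x] r s'.
    - by rewrite inE connect0.
    - by rewrite inE; apply/negP=> /hout[]; rewrite eqxx.
    - by rewrite inE.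
    - by [].
    rewrite !inE in aX bX; have [at' aW] := hout a aX.
    have [bW|bW] := boolP (b \in W).
      rewrite e_sym in eab; have := N' _ _ bW eab.
      rewrite !inE (negPf at') (negPf aW) !orbF => /eqP as'.
      by rewrite as' (negPf rs'X) in aX.
    case/negP: bX; apply: connect_trans aX (connect1 _).
    by rewrite /h /induced /= !inE at' aW bt' bW.
  apply: connect_sub => x y /=; rewrite /h /induced /= => /and3P[].
  rewrite !inE => /andP[_ xW] /andP[_ yW] exy; apply: connect1.
  by rewrite /= !inE xW yW.
have rs' := reach s t N sW rt rs sNt.
have rt' := reach t s (attachedC N) tW rs rt; rewrite eq_sym in rt'.
apply: connect_trans (rt' sNt).
by rewrite (sym_connect_sym (induced_sym e_sym (~: W))).
Qed.

(** The part on the side of s consists of what s reaches without passing through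
    m; the rest of W goes to the part on the side of t. If a part has no inner
    vertex, its terminals are adjacent: otherwise the remaining terminal alone
    would separate W from the terminal of that part. *)
Lemma split_at_cut_vertex m : m \in W -> ~~ connect (avoid (inner W) m) s t ->
  exists W1 W2, [/\ W = m |: (W1 :|: W2), network W1 s m, network W2 m t &
    [/\ s \notin W2, t \notin W1 & forall x, x \in W1 -> x \notin W2]].
Proof.
move=> mW cut; have [sNt sW tW N _ _] := net.
have sNm : s != m by apply: contraNneq sW => ->.
have tNm : t != m by apply: contraNneq tW => ->.
set h := avoid (inner W) m; pose X := [set x | connect h s x].
have sX : s \in X by rewrite inE connect0.
have tX : t \notin X by rewrite inE.
have mX : m \notin X.
  rewrite inE; apply/negP=> hm.
  have [||a [b [_]]] := @connect_leave _ h [set~ m] _ _ hm; rewrite ?inE ?eqxx //.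
  by rewrite negbK => /eqP-> /and3P[_ _]; rewrite eqxx.
have XV x : x \in X -> x != s -> x \in W.
  rewrite inE => hx xs; apply/negPn/negP => xW.
  have xt : x != t by apply: contraTneq hx => ->.
  have [||a [b [_ bV]]] := @connect_leave _ h V _ _ hx.
  - by rewrite !inE eqxx.
  - by rewrite !inE !negb_or xs xt.
  by case/andP=> /inner_closed bV'; rewrite bV' in bV.
have Xstep x y : x \in X -> x != m -> y != m -> inner W x y -> y \in X.
  rewrite !inE => hx xm ym xy; apply: connect_trans hx (connect1 _).
  by rewrite /h /avoid /= xm ym xy.
have XNm x : x \in X -> x != m by move=> xX; apply: contraNneq mX => <-.
exists (X :\ s), (W :\: X :\ m); split.
- apply/setP=> x; rewrite in_setU1 !in_setU !in_setD1 in_setD.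
  have [-> //|xm] := eqVneq x m.
  have [-> /=|xs /=] := eqVneq x s; first by rewrite (negPf sW) andbF.
  by have [/XV->|//] := boolP (x \in X).
- split=> //.
  + by rewrite !inE eqxx.
  + by rewrite in_setD1 (negPf mX) andbF.
  + move=> x y; rewrite in_setD1 => /andP[xs xX] exy.
    have xW := XV x xX xs; rewrite !in_setU !in_set1 in_setD1.
    have [//|ys /=] := eqVneq y s; have [//|ym /=] := eqVneq y m.
    by apply: (Xstep x) => //; [apply: XNm | rewrite /inner /= exy xW].
  + have [esm|esm] := boolP (e s m); [by left | right].
    have [||||a [b [aW bW bt eab]]] := @no_cut t W m s => //.
    have := N _ _ aW eab; rewrite !inE (negPf bt) (negPf bW) !orbF => /eqP bs.
    rewrite bs e_sym in eab; apply/set0Pn; exists a; rewrite in_setD1.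
    have -> : a != s by apply: contraNneq sW => <-.
    apply: (Xstep s) => //; last by rewrite /inner /= eab aW orbT.
    by apply: contraNneq esm => <-.
  + right; exists t; rewrite !in_setU !in_set1 in_setD1 (negPf tX) andbF orbF.
    by rewrite negb_or eq_sym sNt tNm.
- split=> //.
  + by rewrite eq_sym.
  + by rewrite !inE eqxx.
  + by rewrite !in_setD1 in_setD (negPf tW) !andbF.
  + move=> x y; rewrite in_setD1 in_setD => /and3P[xm xX xW] exy.
    have := N _ _ xW exy; rewrite !in_setU !in_set1 in_setD1 in_setD.
    have [//|ym /=] := eqVneq y m.
    have yX : y \notin X.
      apply: contra xX => yX; apply: (Xstep y) => //.
      by rewrite /inner /= e_sym exy xW orbT.
    rewrite yX /=; have [ys|//] := eqVneq y s; by rewrite ys sX in yX.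
  + have [emt|emt] := boolP (e m t); [by left | right].
    have [|||| a [b [aW bW bs eab]]] := @no_cut s W m t => //.
      by rewrite eq_sym.
    have := N _ _ aW eab; rewrite !inE (negPf bs) (negPf bW) !orbF => /eqP bt.
    rewrite bt in eab; apply/set0Pn; exists a; rewrite in_setD1 in_setD aW andbT.
    have am : a != m by apply: contraNneq emt => <-.
    rewrite am; apply: contra tX => aX; apply: (Xstep a) => //.
    by rewrite /inner /= eab aW.
  + right; exists s.
    by rewrite !in_setU !in_set1 in_setD1 in_setD sX !negb_or sNm sNt andbF.
split.
- by rewrite in_setD1 in_setD sX andbF.
- by rewrite in_setD1 (negPf tX) andbF.
by move=> x; rewrite !in_setD1 in_setD => /andP[_ ->]; rewrite andbF.
Qed.

Lemma split_components x y : x \in W -> y \in W ->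
    ~~ connect (induced e W) x y ->
  exists W1 W2, [/\ W = W1 :|: W2, network W1 s t, network W2 s t,
    W1 != set0 /\ W2 != set0 & forall x, x \in W1 -> x \notin W2].
Proof.
move=> xW yW xy; have [sNt sW tW N _ out] := net.
pose X := [set z | connect (induced e W) x z].
have XW : X \subset W.
  apply/subsetP=> z; rewrite inE => hz; apply/negPn/negP=> zW.
  have [||a [b [_ bW]]] := @connect_leave _ _ W _ _ hz; rewrite ?(negPf zW) //.
  by rewrite /induced /= (negPf bW) andbF.
have Xstep a b : a \in X -> b \in W -> e a b -> b \in X.
  move=> aX bW eab; have aW := subsetP XW a aX; move: aX; rewrite !inE => hx.
  by apply: connect_trans hx (connect1 _); rewrite /induced /= aW bW.
have xX : x \in X by rewrite inE connect0.
have yD : y \in W :\: X by rewrite inE yW andbT inE.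
have X0 : X != set0 by apply/set0Pn; exists x.
have D0 : W :\: X != set0 by apply/set0Pn; exists y.
have outS (Z : {set T}) : Z \subset W -> e s t \/ exists r, r \notin [set s; t] :|: Z.
  move=> ZW; case: out => [|[r rV]]; [by left | right; exists r].
  by apply: contra rV => rZ; apply: (subsetP (setUS _ ZW)).
exists X, (W :\: X); split=> //.
- by rewrite -{1}(setID W X) (setIidPr XW).
- split=> //; last exact: outS; last by right.
  + by apply: contra sW; apply/subsetP.
  + by apply: contra tW; apply/subsetP.
  move=> a b aX eab; have aW := subsetP XW a aX.
  have := N _ _ aW eab; rewrite !in_setU => /orP[->//|bW].
  by rewrite (Xstep a b) ?orbT.
- split=> //; last by apply: outS; apply: subsetDl.
  + by rewrite in_setD (negPf sW) andbF.
  + by rewrite in_setD (negPf tW) andbF.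
  + move=> a b; rewrite in_setD => /andP[aX aW] eab.
    have := N _ _ aW eab; rewrite !in_setU in_setD => /orP[->//|bW].
    rewrite bW andbT; apply/orP; right; apply: contra aX => bX.
    by apply: (Xstep b) => //; rewrite e_sym.
  by right.
by move=> a aX; rewrite in_setD aX.
Qed.

(** Both paths from s to t through W have inner vertices, since the edge st does
    not belong to the network. A path inside W from one to the other then ends at
    the branch vertices p and q. *)
Lemma inseparable_K4 : W != set0 ->
    {in W, forall m, connect (avoid (inner W) m) s t} ->
    {in W &, forall x y, connect (induced e W) x y} ->
  exists b p, K4_subdivision e b p.
Proof.
case/set0Pn=> m0 m0W cutless linked; have [sNt sW tW N _ _] := net.
set h := inner W in cutless *.
have hE x y : h x y -> e x y by case/andP.
(* If s could not reach y around x, then x would separate y, together with all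
   the vertices of the network that s does not reach, from the rest: t is reached
   unless x = t, so these vertices are inner and have all their neighbours in
   the network. *)
have noCut x y : x != s -> h x y -> y != s -> connect (avoid h x) s y.
  move=> xs hxy ys; pose X := [set z | connect (avoid h x) s z].
  apply/negPn/negP => yX.
  have xy : x != y by apply: contraTneq hxy => ->; rewrite /h /inner /= e_irr.
  have sX : s \in X by rewrite inE connect0.
  have VX z : z \in V -> z \notin X -> z != x -> z \in W.
    rewrite !in_setU !in_set1 => /orP[/orP[]/eqP->|//].
      by rewrite sX.
    move=> tX tx; case/negP: tX; rewrite inE; apply: cutless.
    rewrite /h inner_sym in hxy; have := inner_closed hxy.
    by rewrite !in_setU !in_set1 (negPf xs) eq_sym (negPf tx).
  have yV := inner_closed hxy.
  have [||||a [b [aZ bZ bx eab]]] := @no_cut x ((V :\: X) :\ x) y s.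
  - by rewrite in_setD1 in_setD eq_sym xy yV inE yX.
  - by rewrite !inE eqxx.
  - by rewrite in_setD1 in_setD sX andbF.
  - by rewrite eq_sym.
  move: aZ bZ; rewrite !in_setD1 !in_setD => /and3P[ax aX aV].
  have aW := VX a aV aX ax; have bV := N _ _ aW eab.
  rewrite bx bV andbT /= negbK => bX; case/negP: aX.
  move: bX; rewrite !inE => hb; apply: connect_trans hb (connect1 _).
  by rewrite /avoid /h /inner /= ax bx e_sym eab aW orbT.
have hst : connect h s t.
  apply: connect_sub (cutless _ m0W) => x y /and3P[hxy _ _].
  exact: connect1.
have [P [Q [hP hQ uPQ]]] := two_paths_connect sNt noCut hst.
have inV z l : path h z l -> {subset l <= V}.
  elim: l z => // a l IHl z /= /andP[/inner_closed aV /IHl lV] b.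
  by rewrite inE => /predU1P[->|/lV].
have sub l : path h s (rcons l t) -> uniq [:: s, t & l] -> {subset l <= W}.
  move=> /inV lV /and3P[sl tl _] z zl.
  have := lV z; rewrite mem_rcons inE zl orbT => /(_ isT).
  rewrite !inE; case: eqP => [zs|_]; first by rewrite -zs inE zl orbT in sl.
  by case: eqP => [zt|//]; rewrite -zt zl in tl.
have uP : uniq [:: s, t & P] by uniq_from uPQ.
have uQ : uniq [:: s, t & Q] by uniq_from uPQ.
have PW := sub P hP uP; have QW := sub Q hQ uQ.
have head l : path h s (rcons l t) -> exists z, z \in l.
  case: l => [|z l] /=; last by exists z; rewrite inE eqxx.
  by rewrite /h /inner /= (negPf sW) (negPf tW) andbF.
have [[x xP] [y yQ]] := (head P hP, head Q hQ).
have xNy : x != y.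
  apply/eqP=> xy; rewrite -{}xy in yQ.
  move: uPQ; rewrite /= cat_uniq => /and3P[_ _ /and3P[_ /hasPn/(_ x yQ)]].
  by rewrite /= xP.
have [R hR uR] := connect_uniq_path xNy (linked x y (PW x xP) (QW y yQ)).
have uR' : uniq R by case/and3P: uR.
have [p [M [q [pP qQ hM uM dM]]]] :=
  linking_path (A := [in P]) (B := [in Q]) hR uR' xP yQ.
have {}pP : p \in P := pP; have {}qQ : q \in Q := qQ.
have {}dM : {in M, forall z, (z \notin P) && (z \notin Q)} := dM.
have MW : {subset M <= W}.
  move=> z zM; have: z \in rcons M q by rewrite mem_rcons inE zM orbT.
  elim: (rcons M q) p hM {pP} => //= a l IHl p /andP[/and3P[_ aW _] hl].
  by rewrite inE => /predU1P[->|/(IHl a hl)].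
have [O hO uO] := connect_uniq_path sNt outside_connect.
have OW : {in O, forall z, z \notin W}.
  move=> z zO; have: z \in rcons O t by rewrite mem_rcons inE zO orbT.
  elim: (rcons O t) s hO => //= a l IHl p' /andP[/and3P[_ aW _] hl].
  by rewrite inE => /predU1P[->|/(IHl a hl)//]; rewrite inE in aW.
have toE (h' : rel T) z l : (forall x y, h' x y -> e x y) -> path h' z l -> path e z l.
  by move=> h'e; apply: sub_path.
have {}hM : path e p (rcons M q) by apply: toE hM => a b /and3P[].
have {}hO : path e s (rcons O t) by apply: toE hO => a b /and3P[].
have uA : uniq ((s :: t :: P ++ Q) ++ M ++ O).
  have uMO : uniq (M ++ O).
    have uO' : uniq O by case/and3P: uO.
    rewrite cat_uniq uM uO' andbT.
    by apply/hasPn=> z /OW; apply: contra; apply: MW.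
  rewrite cat_uniq uPQ uMO andbT; apply/hasPn=> z.
  rewrite mem_cat => /orP[zM|zO].
    rewrite !inE mem_cat; have /andP[/negPf-> /negPf->] := dM z zM.
    have zW := MW z zM; rewrite !orbF negb_or.
    by apply/andP; split; apply: contraTneq zW => ->.
  have zW := OW z zO; rewrite !inE mem_cat !negb_or; case/and3P: uO.
  rewrite inE negb_or => /andP[_ sO] tO _; apply/and4P; split.
  - by apply: contraNneq sO => <-.
  - by apply: contraNneq tO => <-.
  - by apply: contra zW; apply: PW.
  - by apply: contra zW; apply: QW.
have {}hP := toE h _ _ hE hP; have {}hQ := toE h _ _ hE hQ.
clear -hP hQ hM hO uA pP qQ.
case/splitPr: pP => P1 P2 in hP uA; case/splitPr: qQ => Q1 Q2 in hQ uA.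
move: hP hQ; rewrite !rcons_cat !rcons_cons -!cat_rcons !cat_path !last_rcons.
case/andP=> hP1 hP2 /andP[hQ1 hQ2].
apply: K4_of_paths hP1 hQ1 hO hM hP2 hQ2.
by uniq_from uA.
Qed.

End OneNetwork.
(** * Existence of solutions *)

Hypothesis K4_free : series_parallel e.

Definition solvable W s t :=
  [/\ joined_tree W s t, pendant_tree W s & split_forest W s t].

(** Both orientations of the second network are needed: the pendant tree of the
    composition prolongs a joined tree by a tree pendant from m, while a split
    forest uses a tree pendant from t. *)
Lemma series_solvable W1 W2 s m t : let W := m |: (W1 :|: W2) in
    network W s t -> network W1 s m -> network W2 m t ->
    s \notin W2 -> t \notin W1 -> (forall x, x \in W1 -> x \notin W2) ->
    solvable W1 s m -> solvable W2 m t -> solvable W2 t m ->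
  solvable W s t.
Proof.
move=> W net net1 net2 sW2 tW1 disj [j1 p1 _] [j2 p2 _] [_ p2' _].
have [sNt _ _ N _ _] := net.
have [sNm sW1 mW1 N1 _ _] := net1; have [mNt mW2 tW2 N2 _ _] := net2.
have tNm : t != m by rewrite eq_sym.
have f : split_forest W s t by apply: (@series_split W1 W2 s m t).
split=> //; last by apply: (@series_pendant W1 W2 s m t).
have [est|est] := boolP (e s t); first exact: joined_tree_edge.
by apply: (@series_joined W1 W2 s m t).
Qed.

Lemma network_solvable W s t : network W s t -> solvable W s t.
Proof.
have [n ltWn] := ubnP #|W|; elim: n W s t ltWn => // n IHn W s t ltWn net.
have IH W' s' t' : W' \proper W -> network W' s' t' -> solvable W' s' t'.
  by move/proper_card=> ltW'; apply: IHn; apply: leq_trans ltW' ltWn.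
have [sNt sW tW N inn _] := net.
have [W0|Wn0] := eqVneq W set0.
  have est : e s t by case: inn => //; rewrite W0 eqxx.
  have f : split_forest W s t.
    exists [set s; t]; split; [exact: subsetUl | exact: grow_refl |].
    by move=> x y; rewrite W0 in_set0.
  split=> //; first by apply: joined_tree_edge.
  exists [set s]; split; [exact: subsetUl | exact: grow_refl |].
  by move=> x y; rewrite W0 in_set0.
have [/existsP[m /andP[mW cut]]|/existsPn cutless] :=
    boolP [exists m, (m \in W) && ~~ connect (avoid (inner W) m) s t].
  have [W1 [W2 [DW net1 net2 [sW2 tW1 disj]]]] := split_at_cut_vertex net mW cut.
  have [_ _ mW1 _ _ _] := net1; have [_ mW2 _ _ _ _] := net2.
  have prop1 : W1 \proper W.
    apply/properP; split; last by exists m.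
    by rewrite DW; apply/subsetP=> x; rewrite !inE => ->; rewrite orbT.
  have prop2 : W2 \proper W.
    apply/properP; split; last by exists m.
    by rewrite DW; apply/subsetP=> x; rewrite !inE => ->; rewrite !orbT.
  have sol1 := IH _ _ _ prop1 net1; have sol2 := IH _ _ _ prop2 net2.
  have sol2' := IH _ _ _ prop2 (networkC net2).
  rewrite DW in net *.
  exact: series_solvable net net1 net2 sW2 tW1 disj sol1 sol2 sol2'.
have [linked|] := boolP [forall x in W, forall y in W, connect (induced e W) x y].
  case: K4_free; apply: inseparable_K4 net Wn0 _ _.
    by move=> m mW; have:= cutless m; rewrite mW negbK.
  by move=> x y xW yW; have/forall_inP/(_ x xW)/forall_inP/(_ y yW) := linked.
rewrite negb_forall_in => /exists_inP[x xW].
rewrite negb_forall_in => /exists_inP[y yW xy].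
have [W1 [W2 [DW net1 net2 [/set0Pn[a aW1] /set0Pn[b bW2]] disj]]] :=
  split_components net xW yW xy.
have prop1 : W1 \proper W.
  rewrite DW; apply/properP; split; first exact: subsetUl.
  by exists b; rewrite ?inE ?bW2 ?orbT //; apply: contraL bW2 => /disj.
have prop2 : W2 \proper W.
  rewrite DW; apply/properP; split; first exact: subsetUr.
  by exists a; rewrite ?inE ?aW1 ?disj.
have [j1 p1 f1] := IH _ _ _ prop1 net1; have [_ p2 f2] := IH _ _ _ prop2 net2.
have [_ sW1 tW1 _ _ _] := net1; have [_ _ _ N2 _ _] := net2.
rewrite DW; split.
- by apply: (@parallel_joined W1 W2 s t).
- by apply: (@parallel_pendant W1 W2 s t).
- by apply: (@parallel_split W1 W2 s t).
Qed.

End Networks.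

Lemma two_connected_no_cut (T : finType) (e : rel T) v (X : {set T}) x r :
    two_vertex_connected e -> x \in X -> v \notin X -> r \notin X -> r != v ->
  exists a b, [/\ a \in X, b \notin X, b != v & e a b].
Proof.
case=> _ no_cut xX vX rX rv.
have xv : x != v by apply: contraNneq vX => <-.
have: connect (induced e [set~ v]) x r.
  apply/negPn/negP=> xr; apply: (no_cut v) => linked.
  by rewrite linked ?inE in xr.
move=> /connect_leave/(_ xX rX)[a [b [aX bX /and3P[_ bv eab]]]].
exists a, b; split=> //.
by rewrite !inE in bv.
Qed.

Theorem theorem10 (T : finType) (e : rel T)
  (e_sym : symmetric e) (e_irr : irreflexive e)
  (G_2conn : two_vertex_connected e) (G_sp : series_parallel e) :
  exists A I : {set T}, CAI_partition e A I.
Proof.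
have [[/set0Pn[s _] linked] _] := G_2conn.
suffices [A [gA cA]] : exists A, grow e [set s] A /\
    forall x y, x \notin A -> e x y -> y \in A.
  exists A, (~: A); split.
  - exact: setUCr.
  - by rewrite -setI_eq0 setICr.
  - exact: grow_tree gA.
  by move=> x y; rewrite !inE => xA yA; apply: contra yA; apply: cA.
(* If s has no neighbour, the graph, being connected, has no other vertex. *)
have [t est|edgeless] := pickP (e s).
  have sNt : s != t by apply: contraTneq est => ->; rewrite e_irr.
  have net : network e (~: [set s; t]) s t.
    split=> //; [by rewrite !inE eqxx | by rewrite !inE eqxx orbT | | by left | by left].
    by move=> x y _ _; rewrite setUCr inE.
  have cut v X x r := @two_connected_no_cut T e v X x r G_2conn.
  have [[A [_ tA gA cA]] _ _] := network_solvable e_sym e_irr cut G_sp net.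
  have sA : s \in A by apply: (subsetP (grow_sub gA)); rewrite inE.
  exists A; split=> // x y xA; apply: cA => //.
  by rewrite !inE negb_or; apply/andP; split; apply: contraNneq xA => ->.
exists [set s]; split; first exact: grow_refl.
move=> x y xs _; have:= linked s x (in_setT _) (in_setT _).
move=> /connect_leave/(_ (set11 s) xs)[a [b [/set1P-> _ /and3P[_ _]]]].
by rewrite edgeless.
Qed.
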